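(* Let $(X,d)$ be a compact metric space and let $f\in Hom(X)$ be such that $\mathcal{GR}(f)\neq X$. If $\mathcal{CR}(f)\neq X$, then $f$ does not permit $\mathcal{GR}$-full explosions.
   Context: $Hom(X)$ is the space of homeomorphisms of $X$ with the uniform topology induced by $d_{\mathscr{C}^0}(f,g)=\max_{x\in X}d(f(x),g(x))$. Chain recurrence: given $x,y\in X$ and $\varepsilon>0$, an $\varepsilon$-chain for $f$ from $x$ to $y$ is a finite sequence $(x_i)_{i=1}^n$ ($n\ge1$) in $X$ with $x_1=x$ and, setting $x_{n+1}=y$, $d(f(x_i),x_{i+1})<\varepsilon$ for all $i=1,\dots,n$. $\mathcal{CR}(f)$ is the set of $x\in X$ such that for every $\varepsilon>0$ there is an $\varepsilon$-chain from $x$ to $x$. Strong chain recurrence: a strong $\varepsilon$-chain from $x$ to $y$ (for the metric $d$) is a finite sequence $(x_i)_{i=1}^n$ ($n\ge1$) in $X$ with $x_1=x$ and, setting $x_{n+1}=y$, $\sum_{i=1}^n d(f(x_i),x_{i+1})<\varepsilon$. $\mathcal{SCR}_d(f)$ is the set of $x\in X$ such that for every $\varepsilon>0$ there is a strong $\varepsilon$-chain from $x$ to $x$. The generalized recurrent set is $\mathcal{GR}(f)=\bigcap_{d'}\mathcal{SCR}_{d'}(f)$, the intersection being over all metrics $d'$ compatible with the topology of $X$. For $f\in Hom(X)$ with $\mathcal{GR}(f)\neq X$, $f$ does not permit $\mathcal{GR}$-full explosions if there exists a neighborhood $V$ of $f$ in $Hom(X)$ such that if $g\in V$ then $\mathcal{GR}(g)\neq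 X$. *)

(* Defs.v *)
From HB Require Import structures.
From mathcomp Require Import all_boot all_order all_algebra.
From mathcomp Require Import lra.
From mathcomp Require Import all_classical all_reals all_analysis.

Set Implicit Arguments.
Unset Strict Implicit.
Unset Printing Implicit Defensive.

Import Order.TTheory GRing.Theory Num.Theory.
Import numFieldTopology.Exports numFieldNormedType.Exports.

Local Open Scope classical_set_scope.
Local Open Scope ring_scope.

HB.mixin Record isCompact T & Topological T := {
  compact_setT : compact [set: T]
}.

#[short(type="compactMetricType")]
HB.structure Definition CompactMetric (R : numDomainType) :=
  {T of Metric R T & isCompact T}.

(** A chain [x_1, ..., x_n] with [n >= 1] and the convention [x_{n+1} = y] is
    coded by a sequence [s : nat -> X]; the values of [s] outside
    [1, ..., n.+1] play no role. *)
Section chains.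
Context {R : realType} {X : Type}.
Implicit Types (d : X -> X -> R) (f : X -> X) (e : R) (x y : X).

Definition eps_chain d f e x y : Prop :=
  exists (n : nat) (s : nat -> X),
    [/\ (1 <= n)%N, s 1%N = x, s n.+1 = y &
        forall i, (1 <= i <= n)%N -> d (f (s i)) (s i.+1) < e].

Definition strong_eps_chain d f e x y : Prop :=
  exists (n : nat) (s : nat -> X),
    [/\ (1 <= n)%N, s 1%N = x, s n.+1 = y &
        \sum_(1 <= i < n.+1) d (f (s i)) (s i.+1) < e].

Definition SCR d f : set X :=
  [set x | forall e, 0 < e -> strong_eps_chain d f e x x].

Definition is_metric d : Prop :=
  [/\ forall x y, 0 <= d x y,
      forall x y, d x y = 0 <-> x = y,
      forall x y, d x y = d y x &
      forall x y z, d x z <= d x y + d y z].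

End chains.

Definition compatible_metric {R : realType} {X : topologicalType}
    (d : X -> X -> R) : Prop :=
  is_metric d /\
  forall A : set X, open A <->
    forall x, A x -> exists2 e : R, 0 < e & [set y | d x y < e] `<=` A.

Section recurrent_sets.
Context {R : realType} {X : metricType R}.
Implicit Type f : X -> X.

Definition CR f : set X :=
  [set x | forall e : R, 0 < e -> eps_chain mdist f e x x].

Definition GR f : set X :=
  \bigcap_(d in [set d : X -> X -> R | compatible_metric d]) SCR d f.

End recurrent_sets.

Definition is_homeo {X : topologicalType} (f : X -> X) : Prop :=
  continuous f /\
  exists g : X -> X, [/\ cancel f g, cancel g f & continuous g].

Record Homeo {R : realType} (X : compactMetricType R) := MkHomeo {
  homeo_fun :> X -> X;
  homeo_prop : is_homeo homeo_fun
}.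

HB.instance Definition _ (R : realType) (X : compactMetricType R) :=
  gen_eqMixin (Homeo X).
HB.instance Definition _ (R : realType) (X : compactMetricType R) :=
  gen_choiceMixin (Homeo X).

(** The supremum is a maximum when [X] is nonempty, see [dC0_max]. *)
Definition dC0 {R : realType} {X : compactMetricType R} (f g : Homeo X) : R :=
  sup (range (fun x => mdist (f x) (g x))).

Section dC0_metric.
Context {R : realType} {X : compactMetricType R}.
Implicit Types f g h : Homeo X.

Lemma mdist_homeo_continuous f g :
  continuous (fun x => mdist (f x) (g x) : R).
Proof.
move=> x; apply/(@cvgrPdist_lt R R^o) => e e0.
have e20 : 0 < e / 2 by rewrite divr_gt0.
have [cf _] := homeo_prop f; have [cg _] := homeo_prop g.
near=> t.
have ft : mdist (f x) (f t) < e / 2.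
  by near: t; exact: (metricType_numDomainType.cvgr_dist_lt (cf x) e20).
have gt : mdist (g x) (g t) < e / 2.
  by near: t; exact: (metricType_numDomainType.cvgr_dist_lt (cg x) e20).
have h1 := metric_triangle (f x) (f t) (g x).
have h2 := metric_triangle (f t) (g t) (g x).
have h3 := metric_triangle (f t) (f x) (g t).
have h4 := metric_triangle (f x) (g x) (g t).
rewrite (metric_sym (g t)) in h2; rewrite (metric_sym (f t) (f x)) in h3.
by rewrite ltr_norml; apply/andP; split; lra.
Unshelve. all: by end_near. Qed.

Lemma dC0_max f g : [set: X] !=set0 ->
  exists2 x, dC0 f g = mdist (f x) (g x) &
             forall t, mdist (f t) (g t) <= mdist (f x) (g x).
Proof.
move=> X0.
have [] := compact_EVT_max X0 compact_setT
  (continuous_subspaceT (@mdist_homeo_continuous f g)).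
move=> x _ xmax; exists x => [|t]; last by apply: xmax; rewrite in_setT.
apply/le_anti/andP; split.
  apply: ge_sup; first by exists (mdist (f x) (g x)); exists x.
  by move=> _ [t _ <-]; apply: xmax; rewrite in_setT.
apply: ub_le_sup; last by exists x.
by exists (mdist (f x) (g x)) => _ [t _ <-]; apply: xmax; rewrite in_setT.
Qed.

Lemma le_dC0 f g x : mdist (f x) (g x) <= dC0 f g.
Proof. by have [|y -> ] := @dC0_max f g; first by exists x. Qed.

Let X0P : [set: X] !=set0 \/ (forall f g, dC0 f g = 0).
Proof.
have [E|/set0P X0] := eqVneq [set: X] set0; [right => f g|by left].
by rewrite /dC0 E image_set0 sup0.
Qed.

Let dC0xx f : dC0 f f = 0.
Proof. by have [/(dC0_max f f)[x -> _]|->//] := X0P; rewrite mdistxx. Qed.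

Let dC0_positivity f g : dC0 f g = 0 -> f = g.
Proof.
move=> fg0; have fg : homeo_fun f = homeo_fun g.
  apply/funext => x; apply: mdist_positivity; apply/le_anti.
  by rewrite -{1}fg0 le_dC0 mdist_ge0.
case: f g fg {fg0} => [f hf] [g hg] /= fg.
by case: _ / fg hg => hg; rewrite (Prop_irrelevance hf hg).
Qed.

Let dC0_sym f g : dC0 f g = dC0 g f.
Proof.
by rewrite /dC0; under eq_fun do rewrite metric_sym.
Qed.

Let dC0_triangle g f h : dC0 f h <= dC0 f g + dC0 g h.
Proof.
have [/(dC0_max f h)[x -> _]|E] := X0P; last by rewrite !E addr0.
by rewrite (le_trans (metric_triangle _ (g x) _))// lerD// le_dC0.
Qed.

HB.instance Definition _ := isMetric.Build R (Homeo X)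
  dC0xx dC0_positivity dC0_sym dC0_triangle.

End dC0_metric.

Definition no_GR_full_explosions {R : realType} {X : compactMetricType R}
    (f : Homeo X) : Prop :=
  exists2 V : set (Homeo X), nbhs f V & forall g, V g -> GR g <> [set: X].

(* Main.v *)
(** If [x] lies on no [e]-chain of [f] from [x] to itself, then it lies on no
    [e/2]-chain of any [g] with [d(f, g) < e/2]. Since a strong [e/2]-chain is
    in particular an [e/2]-chain and [d] itself is among the metrics defining
    [GR g], the point [x] is not in [GR g]. *)
Require Import Defs.
From HB Require Import structures.
From mathcomp Require Import all_boot all_order all_algebra.
From mathcomp Require Import all_classical all_reals all_analysis.

Import Order.TTheory GRing.Theory Num.Theory.

Local Open Scope classical_set_scope.
Local Open Scope ring_scope.

Lemma mdist_compatible (R : realType) (X : metricType R) :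
  compatible_metric (@mdist R X).
Proof.
split.
  split; [exact: mdist_ge0| |exact: metric_sym|].
    by move=> x y; split=> [/mdist_positivity//|->]; rewrite mdistxx.
  by move=> x y z; exact: metric_triangle.
(* After [openE], openness is a neighbourhood condition at each point of [A], and the basic balls
   are the [mdist]-balls. *)
move=> A; rewrite openE; split=> Aop x Ax.
  have /nbhs_ballP[e e0 xeA] := Aop x Ax.
  by exists e => //; rewrite -ballEmdist.
have [e e0 xeA] := Aop x Ax.
by apply/nbhs_ballP; exists e => //; rewrite ballEmdist.
Qed.

Lemma GR_sub_SCR_mdist (R : realType) (X : metricType R) (f : X -> X) :
  GR f `<=` SCR (@mdist R X) f.
Proof. by move=> x; apply; exact: mdist_compatible. Qed.

(** As all jumps are nonnegative, each one is at most their sum. *)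
Lemma strong_eps_chain_eps_chain (R : realType) (X : Type) (d : X -> X -> R)
    (f : X -> X) (e : R) (x y : X) : (forall a b, 0 <= d a b) ->
  strong_eps_chain d f e x y -> eps_chain d f e x y.
Proof.
move=> d0 [n [s [n1 s1 sn lt_e]]]; exists n, s; split=> // i /andP[i1 ilen].
apply: le_lt_trans lt_e.
rewrite (bigD1_seq i) ?iota_uniq ?mem_index_iota ?ltnS ?i1//=.
by rewrite lerDl sumr_ge0.
Qed.

(** The same points serve for [f]: going through [g (s i)] adds at most [a] to each jump, and
    strictness comes from the bound [b]. *)
Lemma eps_chain_perturb (R : realType) (X : metricType R) (f g : X -> X)
    (a b : R) (x y : X) : (forall z, mdist (f z) (g z) <= a) ->
  eps_chain mdist g b x y -> eps_chain mdist f (a + b) x y.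
Proof.
move=> fg [n [s [n1 s1 sn lt_b]]]; exists n, s; split=> // i ni.
by rewrite (le_lt_trans (metric_triangle _ (g (s i)) _))// ler_ltD// lt_b.
Qed.

Theorem proposition3p3 (R : realType) (X : compactMetricType R) (f : Homeo X)
    (GRf : GR f <> [set: X]) :
  CR f <> [set: X] -> no_GR_full_explosions f.
Proof.
move=> /eqP/setTPn[x /existsNP[e /not_implyP[e0 nchain]]].
have e20 : 0 < e / 2 by rewrite divr_gt0.
(* The same point [x] will be missing from [GR g] for every [g] in this ball. *)
exists (ball f (e / 2)); first exact: nbhsx_ballx.
(* One half of [e] pays for replacing [g] by [f], the other bounds the jumps of the chain for
   [g]. *)
move=> g; rewrite ballEmdist /= => fg GRg; apply: nchain; rewrite (splitr e).
apply: (@eps_chain_perturb _ _ f g).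
  by move=> z; rewrite (le_trans (le_dC0 f g z))// ltW.
apply: strong_eps_chain_eps_chain; first exact: mdist_ge0.
by apply: GR_sub_SCR_mdist => //; rewrite GRg.
Qed.
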